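(* Let $\sigma>0$ and let $f:\mathbb{R}\to\mathbb{C}$ be the characteristic function of a probability density $\varphi$. Suppose that there exist $a>0$ and a measurable set $E\subset[0,a)$ such that $|E|>0$ and $$\bigl|(E+a\mathbb{Z})\cap S_{\varphi}\bigr|=0 .$$ Let $g:\mathbb{R}\to\mathbb{C}$ be a characteristic function such that $f(t)=g(t)$ for all $t\in U_\sigma$. If $$a\le \frac{2\pi}{\sigma},$$ then $f(t)=g(t)$ for all $t\in\mathbb{R}$.
   Context: A characteristic function is the Fourier transform $\hat\mu(t)=\int_{\mathbb{R}}e^{-itx}\,d\mu(x)$, $t\in\mathbb{R}$, of a probability measure $\mu$ (Borel, on $\mathbb{R}$). A probability density is a function $\varphi\in L^1(\mathbb{R})$ with $\varphi\ge 0$ almost everywhere and $\|\varphi\|_{L^1(\mathbb{R})}=1$; its characteristic function is $\hat\varphi(t)=\int_{\mathbb{R}}e^{-itx}\varphi(x)\,dx$. For $\sigma>0$, $U_\sigma=\{x\in\mathbb{R}:|x|>\sigma\}$. For a measurable $\varphi:\mathbb{R}\to\mathbb{R}$, the essential support $S_\varphi$ is the set of all $x\in\mathbb{R}$ such that for every $\varepsilon>0$ the set $(x-\varepsilon,x+\varepsilon)\cap\{t\in\mathbb{R}:|\varphi(t)|>0\}$ has positive Lebesgue measure. $|\cdot|$ applied to a measurable subset of $\mathbb{R}$ is Lebesgue measure, and $E+a\mathbb{Z}=\{x+an: x\in E,\ n\in\mathbb{Z}\}$. *)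

(* Defs.v *)
From mathcomp Require Import all_boot all_order all_algebra.
From mathcomp Require Import all_classical all_reals all_analysis.
From mathcomp Require Export complex.
Set Implicit Arguments.
Unset Strict Implicit.
Unset Printing Implicit Defensive.
Import Order.TTheory GRing.Theory Num.Theory.
Import numFieldNormedType.Exports.

Local Open Scope classical_set_scope.
Local Open Scope ring_scope.
Local Open Scope complex_scope.

(* The real line with its Lebesgue (Caratheodory) sigma-algebra, on which
   [completed_lebesgue_measure] is defined; [measurableTypeR R] is the real
   line with its Borel sigma-algebra. *)
Definition lebesgueTypeR (R : realType) :=
  caratheodory_type (R := R) ((@wlength R idfun)^*)%mu.

Definition leb (R : realType) :
    {measure set (lebesgueTypeR R) -> \bar R} :=
  @completed_lebesgue_measure R.

Definition expi (R : realType) (u : R) : R[i] := cos u +i* sin u.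

Definition cintegral (R : realType) d (T : measurableType d)
    (mu : {measure set T -> \bar R}) (F : T -> R[i]) : R[i] :=
  (\int[mu]_x complex.Re (F x)) +i* (\int[mu]_x complex.Im (F x)).

Definition char_fun (R : realType) (mu : probability (measurableTypeR R) R)
    (t : R) : R[i] :=
  cintegral mu (fun x : R => expi (- (t * x))).

Definition is_char_fun (R : realType) (g : R -> R[i]) : Prop :=
  exists mu : probability (measurableTypeR R) R, g = char_fun mu.

(* Integrability includes measurability for the Lebesgue sigma-algebra. *)
Definition probability_density (R : realType) (phi : R -> R) : Prop :=
  [/\ (leb R).-integrable [set: R] (EFin \o phi),
      {ae leb R, forall x, 0 <= phi x} &
      ('N[leb R]_1[EFin \o phi] = 1)%E].

Definition density_char_fun (R : realType) (phi : R -> R) (t : R) : R[i] :=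
  cintegral (leb R) (fun x : R => expi (- (t * x)) * (phi x)%:C).

Definition U (R : realType) (sigma : R) : set R := [set x | sigma < `|x|].

Definition ess_support (R : realType) (phi : R -> R) : set R :=
  [set x | forall e : R, 0 < e ->
    (0 < leb R (`](x - e)%R, (x + e)%R[ `&` [set t | (0 < `|phi t|)%R]))%E].

Definition periodization (R : realType) (E : set R) (a : R) : set R :=
  [set x + a * n%:~R | x in E & n in [set: int]].

(* Main.v *)
Require Import Defs.
From mathcomp Require Import all_boot all_order all_algebra.
From mathcomp Require Import all_classical all_reals all_analysis.
From mathcomp Require Import measurable_realfun ring lra zify.
Import Order.TTheory GRing.Theory Num.Theory.
Import numFieldNormedType.Exports.

(** Put w = 2 pi / a, so that sigma <= w, and let nu be the finite signed
    measure mu - phi dx, where g is the characteristic function of mu. Its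
    transform t |-> int e^(itx) dnu, which is g - f at - t, vanishes for |t| > sigma, hence by continuity for
    |t| >= w, and it vanishes at 0 because both measures have mass 1. The claim
    is that it vanishes at every s in ]0, w[; negative s follow because nu is
    real.

    Fold nu modulo a. The Fourier coefficients of the folded measure are the
    values of the transform of nu at the multiples of w, which are all zero, so
    the folded measure is zero. Since phi vanishes almost everywhere on E + aZ,
    and mu is nonnegative, mu does not charge X + aZ either, for a Borel set X
    contained in E of positive measure ([difference_functional_null]).

    Now fold e^(isx) nu instead. Its coefficients are the values of the
    transform of nu at the points s + kw, and only two of them, s and s - w, lie
    in the band ]-w, w[. The folded measure is therefore a trigonometric
    polynomial (c + d e^(iwx)) / a times the Lebesgue measure. It vanishes on X by the
    first step, so the polynomial vanishes almost everywhere on X, in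
    particular at two distinct points of [0, a[. As x -> e^(iwx) is injective
    there, c = d = 0, and c is the transform of nu at s
    ([band_limited_null]).

    Measures enter only through the functionals h |-> int h dm, and all are
    handled at once as linear functionals on bounded Borel functions that are
    continuous for bounded pointwise convergence ([sigma_continuous]). That a
    folded measure is determined by its Fourier coefficients becomes
    [periodic_null]: such a functional vanishes on the indicators of periodic
    Borel sets as soon as it vanishes on trigonometric polynomials. This is a
    pi-lambda argument, whose pi-system consists of the sets whose indicator is
    a pointwise limit of [0, 1]-valued trigonometric polynomials.

    To stay with real integrals, the transform of a functional N is read through
    C(t, b) = N(cos(t x + b)), the real part of e^(ib) N(e^(itx)): the transform
    vanishes at t exactly when C(t, b) = 0 for all b. *)

Set Implicit Arguments.
Unset Strict Implicit.
Unset Printing Implicit Defensive.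

Local Open Scope classical_set_scope.
Local Open Scope ring_scope.

(** * Functionals continuous for bounded pointwise convergence *)

Section sigma_continuous_functionals.
Context (R : realType).
Implicit Types (h k w : R -> R) (l : (R -> R) -> R).

Definition bounded_borel h : Prop :=
  measurable_fun [set: R] h /\ exists M, forall x, `|h x| <= M.

(** These are the integrals against finite signed measures; the abstraction lets
    one argument serve measures living on two different sigma-algebras. *)
Definition sigma_continuous l : Prop :=
  (forall r h k, bounded_borel h -> bounded_borel k ->
     l (fun x => r * h x + k x) = r * l h + l k) /\
  (forall (h_ : nat -> R -> R) h (M : R), (forall n, measurable_fun [set: R] (h_ n)) ->
     (forall n x, `|h_ n x| <= M) ->
     (forall x, h_ ^~ x @ \oo --> h x) ->
     (fun n => l (h_ n)) @ \oo --> l h).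

Lemma bounded_borelM h k : bounded_borel h -> bounded_borel k ->
  bounded_borel (fun x => h x * k x).
Proof.
move=> [mh [M hM]] [mk [N kN]]; split; first exact: measurable_funM.
exists (M * N) => x; rewrite normrM ler_pM //.
Qed.

Lemma bounded_borelD h k : bounded_borel h -> bounded_borel k ->
  bounded_borel (fun x => h x + k x).
Proof.
move=> [mh [M hM]] [mk [N kN]]; split; first exact: measurable_funD.
by exists (M + N) => x; rewrite (le_trans (ler_normD _ _))// lerD.
Qed.

Lemma bounded_borel_cst r : bounded_borel (fun=> r).
Proof. by split; [exact: measurable_cst|exists `|r|]. Qed.

Lemma bounded_borelZ r h : bounded_borel h -> bounded_borel (fun x => r * h x).
Proof. exact: bounded_borelM (bounded_borel_cst r). Qed.

Lemma sigma_continuousZ (l : (R -> R) -> R) r h : sigma_continuous l -> bounded_borel h ->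
  l (fun x => r * h x) = r * l h.
Proof.
move=> [lL _] bh.
have l0 : l (fun=> 0) = 0.
  have := lL 1 _ _ (bounded_borel_cst 0) (bounded_borel_cst 0).
  under eq_fun do rewrite mulr0 addr0.
  by rewrite mul1r => /esym/eqP; rewrite -subr_eq0 addrK => /eqP.
have := lL r _ _ bh (bounded_borel_cst 0).
by under eq_fun do rewrite addr0; rewrite l0 addr0.
Qed.

Lemma sigma_continuousD (l : (R -> R) -> R) g h : sigma_continuous l -> bounded_borel g ->
  bounded_borel h -> l (fun x => g x + h x) = l g + l h.
Proof.
move=> [lL _] bg bh; rewrite -[l g]mul1r -lL//.
by under [in RHS]eq_fun do rewrite mul1r.
Qed.

Lemma sigma_continuousB l1 l2 : sigma_continuous l1 -> sigma_continuous l2 ->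
  sigma_continuous (fun h => l1 h - l2 h).
Proof.
move=> [l1L l1C] [l2L l2C]; split=> [r h k bh bk|h_ h M mh hM hh].
  by rewrite l1L// l2L//; ring.
by apply: cvgB; [exact: (l1C _ _ M)|exact: (l2C _ _ M)].
Qed.

(** Multiplying the measure by a bounded weight; the weight cos(s x + b) moves the
    transform by s and by - s. *)
Lemma sigma_continuousM l w : sigma_continuous l -> bounded_borel w ->
  sigma_continuous (fun h => l (fun x => h x * w x)).
Proof.
move=> [lL lC] bw; split=> [r h k bh bk|h_ h M mh hM hh].
  rewrite -lL; [|exact: bounded_borelM..].
  by congr l; apply/funext => x; ring.
have [mw [N wN]] := bw.
apply: (lC _ _ (M * N)) => [n|n x|x]; first exact: measurable_funM.
  by rewrite normrM ler_pM.
by apply: cvgMl; exact: hh.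
Qed.

Lemma integrable_boundedM d (T : measurableType d)
    (m : {measure set T -> \bar R}) (w : T -> R) (p : T -> R) h :
  measurable_fun setT p ->
  m.-integrable setT (EFin \o w) -> bounded_borel h ->
  m.-integrable setT (fun x => (h (p x) * w x)%:E).
Proof.
move=> mp iw [mh [M hM]].
have mw : measurable_fun setT w by apply/measurable_EFinP; exact: measurable_int iw.
apply: (@le_integrable _ _ _ m _ measurableT _ (fun x => (M%:E * (w x)%:E)%E)).
- by apply/measurable_EFinP; apply: measurable_funM => //; exact: measurableT_comp.
- move=> x _ /=; rewrite lee_fin !normrM ler_wpM2r//.
  exact: le_trans (hM _) (ler_norm _).
- exact: integrableZl.
Qed.

(** Dominated convergence. The measurable map p is there to integrate Borel
    functions over the same line with a finer sigma-algebra. *)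
Lemma sigma_continuous_integral d (T : measurableType d)
    (m : {measure set T -> \bar R}) (w : T -> R) (p : T -> R) :
  measurable_fun setT p ->
  m.-integrable setT (EFin \o w) ->
  sigma_continuous (fun h => \int[m]_x (h (p x) * w x)).
Proof.
move=> mp iw; have ib := integrable_boundedM mp iw.
have mw : measurable_fun setT w by apply/measurable_EFinP; exact: measurable_int iw.
split=> [r h k bh bk|h_ h M mh hM hh].
  under eq_Rintegral do rewrite mulrDl -mulrA.
  rewrite RintegralD//; last 2 first.
  - have := ib _ (bounded_borelZ r bh).
    by under [in X in X -> _]eq_fun do rewrite -mulrA.
  - exact: ib.
  by rewrite RintegralZl//; exact: ib.
have mhl : measurable_fun setT h.
  apply: (@measurable_fun_cvg _ _ _ _ (fun n => h_ n)) => //.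
have lim_h x : `|h x| <= M.
  have hx : (fun n => `|h_ n x|) @ \oo --> `|h x| by apply: cvg_norm; exact: hh.
  rewrite -(cvg_lim _ hx)//; apply: limr_le; first by apply/cvg_ex; exists `|h x|.
  by near=> n; exact: hM.
apply: fine_cvg; rewrite fineK; last first.
  by apply: integrable_fin_num => //; apply: ib; split => //; exists M.
have [| | | | |_ _] := @dominated_convergence _ _ _ m _ measurableT
  (fun n x => (h_ n (p x) * w x)%:E) (fun x => (h (p x) * w x)%:E)
  (fun x => (M%:E * `|(w x)%:E|)%E).
- move=> n; apply/measurable_EFinP; apply: measurable_funM => //.
  exact: measurableT_comp.
- by apply/measurable_EFinP; apply: measurable_funM => //; exact: measurableT_comp.
- apply: aeW => x _ /=; apply: cvg_EFin; first by near=> n.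
  by apply: cvgMl; exact: hh.
- by apply: integrableZl => //; exact: integrable_abse.
- by apply: aeW => x n _ /=; rewrite lee_fin normrM ler_wpM2r.
by apply.
Unshelve. all: by end_near. Qed.

End sigma_continuous_functionals.

(** * Trigonometric polynomials and their pointwise limits *)

Section trig_polynomials.
Context (R : realType) (w : R).
Implicit Types (p q : R -> R) (k : int) (r b : R).

(** A phase b in each term makes this family, which has no sine, closed under
    products by a single addition formula ([trig_mul]). *)
Inductive trig_poly : (R -> R) -> Prop :=
| trig_cos r k b : trig_poly (fun x => r * cos (k%:~R * w * x + b))
| trig_add p q : trig_poly p -> trig_poly q -> trig_poly (fun x => p x + q x).

Lemma trig_cst r : trig_poly (fun=> r).
Proof.
have -> : (fun=> r) = (fun x => r * cos (0%:~R * w * x + 0)); last exact: trig_cos.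
by apply/funext => x; rewrite !mul0r add0r cos0 mulr1.
Qed.

Lemma cosMcos (x y : R) : cos x * cos y = (cos (x + y) + cos (x - y)) / 2.
Proof. by rewrite cosD cosB; lra. Qed.

Lemma trig_mul p q : trig_poly p -> trig_poly q -> trig_poly (fun x => p x * q x).
Proof.
move=> tp tq; elim: tp => [r k b|p1 p2 _ IH1 _ IH2]; last first.
  under eq_fun do rewrite mulrDl; exact: trig_add.
elim: tq => [s l c|q1 q2 _ IH1 _ IH2]; last first.
  under eq_fun do rewrite mulrDr; exact: trig_add.
have -> : (fun x => r * cos (k%:~R * w * x + b) * (s * cos (l%:~R * w * x + c))) =
  (fun x => r * s / 2 * cos ((k + l)%:~R * w * x + (b + c)) +
            r * s / 2 * cos ((k - l)%:~R * w * x + (b - c))).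
  apply/funext => x; rewrite mulrACA cosMcos intrD intrB -mulrDr mulrA mulrAC.
  by congr (_ * (cos _ + cos _)); ring.
by apply: trig_add; exact: trig_cos.
Qed.

Lemma trig_exp p n : trig_poly p -> trig_poly (fun x => p x ^+ n).
Proof.
move=> tp; elim: n => [|n IHn]; first exact: trig_cst.
under eq_fun do rewrite exprS; exact: trig_mul.
Qed.

Lemma trig_1B p : trig_poly p -> trig_poly (fun x => 1 - p x).
Proof.
move=> tp; apply: trig_add; first exact: trig_cst.
under eq_fun do rewrite -mulN1r; apply: trig_mul => //; exact: trig_cst.
Qed.

Lemma continuous_cos_affine r b : continuous (fun x : R => cos (r * x + b)).
Proof.
move=> x.
apply: (@continuous_comp _ _ _ (fun x => r * x + b) cos); last exact: continuous_cos.
by apply: cvgD; [apply: cvgM; [exact: cvg_cst|exact: cvg_id]|exact: cvg_cst].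
Qed.

Lemma bounded_borel_cos r b : bounded_borel (fun x : R => cos (r * x + b)).
Proof.
split; last by exists 1 => x; exact: cos_max.
by apply: continuous_measurable_fun; exact: continuous_cos_affine.
Qed.

Lemma trig_bounded_borel p : trig_poly p -> bounded_borel p.
Proof.
elim=> [r k b|{}p q _ IHp _ IHq].
  exact: bounded_borelZ (bounded_borel_cos _ _).
exact: bounded_borelD.
Qed.

(** All Fourier coefficients of l, read modulo the period 2 pi / w, are zero. *)
Definition trig_null (l : (R -> R) -> R) : Prop :=
  forall k b, l (fun x => cos (k%:~R * w * x + b)) = 0.

Lemma trig_null_poly l p : sigma_continuous l -> trig_null l -> trig_poly p -> l p = 0.
Proof.
move=> fl l0; elim=> [r k b|{}p q tp IHp tq IHq].
  by rewrite sigma_continuousZ ?l0 ?mulr0//; exact: bounded_borel_cos.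
by rewrite sigma_continuousD ?IHp ?IHq ?addr0//; exact: trig_bounded_borel.
Qed.

(** The pi-system of the uniqueness argument: closed under intersection because
    products of trigonometric polynomials are trigonometric polynomials, and
    annihilated by every functional with zero coefficients, because the
    approximations are bounded. *)
Definition trig_limit (A : set R) : Prop := exists p_ : nat -> R -> R,
  [/\ forall n, trig_poly (p_ n), forall n x, 0 <= p_ n x <= 1 &
      forall x, p_ ^~ x @ \oo --> (\1_A x : R)].

Lemma trig_limitI : setI_closed trig_limit.
Proof.
move=> A B [p [tp p01 pA]] [q [tq q01 qB]].
exists (fun n x => p n x * q n x); split=> [n|n x|x].
- exact: trig_mul.
- have /andP[p0 p1] := p01 n x; have /andP[q0 q1] := q01 n x.
  by rewrite mulr_ge0//= mulr_ile1.
- by rewrite indicI; apply: cvgM.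
Qed.

Lemma trig_limit_measurable A : trig_limit A -> measurable A.
Proof.
move=> [p [tp _ pA]]; apply/(measurable_indicP R).
apply: (measurable_fun_cvg (h := p)) => // n.
by case: (trig_bounded_borel (tp n)).
Qed.

Lemma trig_null_limit l A : sigma_continuous l -> trig_null l -> trig_limit A ->
  l (\1_A) = 0.
Proof.
move=> fl l0 [p [tp p01 pA]]; have [_ lC] := fl.
have /cvg_lim : (fun n => l (p n)) @ \oo --> l (\1_A).
  apply: (lC _ _ 1) => // [n|n x]; first by case: (trig_bounded_borel (tp n)).
  by have /andP[p0 p1] := p01 n x; rewrite ger0_norm.
move=> <- //; apply/cvg_lim => //; apply: cvg_near_cst; apply: nearW => n.
exact: trig_null_poly.
Qed.

End trig_polynomials.

Lemma indic_ndseq_cvg (T : Type) (R : realType) (F : (set T)^nat) x :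
  nondecreasing_seq F ->
  (fun n => \1_(F n) x : R) @ \oo --> (\1_(\bigcup_n F n) x : R).
Proof.
move=> ndF; apply: cvg_near_cst.
have [[n _ Fnx]|nFx] := pselect ((\bigcup_n F n) x).
  near=> m; rewrite !indicE !mem_set//; first by exists n.
  suff : F n `<=` F m by apply.
  by apply/subsetPset/ndF; near: m; exists n.
by apply: nearW => m; rewrite !indicE !memNset// => Fmx; apply: nFx; exists m.
Unshelve. all: by end_near. Qed.

Lemma bounded_borel_indic (R : realType) (A : set R) : measurable A ->
  bounded_borel (\1_A : R -> R).
Proof.
move=> mA; split; first exact: measurable_indic.
by exists 1 => x; rewrite indicE; case: (_ \in _); rewrite ?normr1 ?normr0.
Qed.

Lemma lambda_system_null (R : realType) (l : (R -> R) -> R) :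
  sigma_continuous l -> l (fun=> 1) = 0 ->
  lambda_system setT [set A | measurable A /\ l (\1_A) = 0].
Proof.
move=> fl l1; split => //=.
- by split => //; rewrite indicT.
- move=> A B BA [mA lA] [mB lB]; split; first exact: measurableD.
  have -> : (\1_(A `\` B) : R -> R) = (fun x => \1_A x + -1 * \1_B x).
    apply/funext => x; rewrite !indicE in_setD.
    have [xB|/= _] := boolP (x \in B); last by rewrite andbT; ring.
    have -> : x \in A by apply/mem_set/BA/set_mem.
    by rewrite /=; ring.
  rewrite sigma_continuousD ?sigma_continuousZ ?lA ?lB ?mulr0 ?addr0//;
    try exact: bounded_borel_indic.
  exact: bounded_borelZ (bounded_borel_indic mB).
- move=> F ndF HF; split; first by apply: bigcupT_measurable => n; exact: (HF n).1.
  have [_ lC] := fl.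
  have /cvg_lim : (fun n => l (\1_(F n))) @ \oo --> l (\1_(\bigcup_n F n)).
    apply: (lC _ _ 1) => [n|n x|x].
    + by apply: measurable_indic; exact: (HF n).1.
    + by rewrite indicE; case: (_ \in _); rewrite ?normr1 ?normr0.
    + exact: indic_ndseq_cvg.
  move=> <- //; apply/cvg_lim => //; apply: cvg_near_cst; apply: nearW => n.
  exact: (HF n).2.
Qed.

Section step.
Context (R : realType).
Implicit Types x r v : R.

(** The left-hand side is a sum of n copies of (1 - r) r^n, each at most
    (1 - r) r^i for i < n, and these add up to 1 - r^n. *)
Lemma natmul_expr_bound r n : 0 <= r <= 1 -> n%:R * (1 - r) * r ^+ n <= 1 - r ^+ n.
Proof.
move=> /andP[r0 r1]; elim: n => [|n IHn]; first by rewrite !mul0r expr0 subrr.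
rewrite -natr1 exprS.
have rn0 : 0 <= r ^+ n by exact: exprn_ge0.
have rn1 : r ^+ n <= 1 by exact: exprn_ile1.
have := ler_wpM2l r0 IHn.
have : 0 <= (1 - r) * (1 - r * r ^+ n).
  by rewrite mulr_ge0 ?subr_ge0 ?mulr_ile1.
lra.
Qed.

(** The previous bound, used at s = sqrt r, leaves a spare factor s^n. *)
Lemma cvg_natmul_expr r : 0 <= r < 1 -> (fun n => n%:R * r ^+ n) @ \oo --> (0 : R).
Proof.
move=> /andP[r0 r1]; pose s := Num.sqrt r.
have s0 : 0 <= s by exact: sqrtr_ge0.
have sr : s * s = r by rewrite -expr2 sqr_sqrtr.
have s1 : s < 1 by rewrite ltNge; apply/negP => s1; nra.
have Hs : (fun n => (1 - s)^-1 * s ^+ n) @ \oo --> (0 : R).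
  rewrite -(mulr0 (1 - s)^-1); apply: cvgMr.
  by apply: cvg_expr; rewrite ger0_norm.
apply: (squeeze_cvgr _ (cvg_cst 0) Hs); apply: nearW => n.
rewrite mulr_ge0 ?exprn_ge0//= -sr exprMn mulrA ler_wpM2r ?exprn_ge0//.
rewrite -[leRHS]mul1r ler_pdivlMr ?subr_gt0//.
have := @natmul_expr_bound s n; rewrite s0 ltW// => /(_ isT).
have := exprn_ge0 n s0; lra.
Qed.

Lemma bernoulli_ge x n : 0 <= x <= 1 -> 1 - n%:R * x <= (1 - x) ^+ n.
Proof.
move=> /andP[x0 x1]; elim: n => [|n IHn]; first by rewrite mul0r subr0 expr0.
rewrite -natr1 exprS.
have n0 : 0 <= n%:R :> R by [].
have := ler_wpM2l (_ : 0 <= 1 - x) IHn.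
rewrite subr_ge0 => /(_ x1); have := mulr_ge0 n0 (mulr_ge0 x0 x0); lra.
Qed.

Lemma bernoulli_le x n : 0 <= x <= 1 -> (1 - x) ^+ n * (1 + n%:R * x) <= 1.
Proof.
move=> /andP[x0 x1]; elim: n => [|n IHn]; first by rewrite mul0r addr0 expr0 mulr1.
apply: le_trans IHn; rewrite -natr1 exprSr -mulrA ler_wpM2l ?exprn_ge0 ?subr_ge0//.
have n0 : 0 <= n%:R :> R by [].
have := mulr_ge0 n0 (mulr_ge0 x0 x0); have := mulr_ge0 x0 x0; lra.
Qed.

(** An explicit sequence of polynomials tending to a step function. With
    m = n 2^n, Bernoulli gives 1 - m v^n <= (1 - v^n)^m <= 1 / (1 + m v^n), and
    m v^n = n (2v)^n tends to 0 when v < 1/2, to infinity otherwise. The extra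
    factor n in m is what settles the value at v = 1/2. *)
Lemma cvg_step v : 0 <= v <= 1 ->
  (fun n => (1 - v ^+ n) ^+ (n * 2 ^ n)) @ \oo --> ((v < 1 / 2)%R%:R : R).
Proof.
move=> /andP[v0 v1].
have vn n : 0 <= v ^+ n <= 1 by rewrite exprn_ge0// exprn_ile1.
have E n : (n * 2 ^ n)%:R * v ^+ n = n%:R * (2 * v) ^+ n.
  by rewrite natrM natrX exprMn mulrA.
have [v2|v2] := ltP v (1/2).
  have H : (fun n => 1 - n%:R * (2 * v) ^+ n) @ \oo --> (1 : R).
    rewrite -[X in _ --> X]subr0; apply: cvgB; first exact: cvg_cst.
    by apply: cvg_natmul_expr; lra.
  rewrite mulr1n; apply: (squeeze_cvgr _ H (cvg_cst (1 : R))); apply: nearW => n.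
  rewrite -E bernoulli_ge//= exprn_ile1//; have := vn n; lra.
rewrite mulr0n; apply: (squeeze_cvgr _ (cvg_cst (0 : R)) (@cvg_harmonic R)); apply: nearW => n.
have /andP[vn0 vn1] := vn n.
rewrite exprn_ge0 ?subr_ge0//= /harmonic -[leRHS]mul1r ler_pdivlMr//.
apply: le_trans (bernoulli_le (n * 2 ^ n) (vn n)).
rewrite ler_wpM2l ?exprn_ge0 ?subr_ge0// -nat1r lerD2l E.
rewrite -[leLHS]mulr1 ler_wpM2l// exprn_ege1//; lra.
Qed.

End step.

Section periodic.
Context (R : realType) (a w : R).
Hypotheses (a_gt0 : 0 < a) (waE : w * a = 2 * pi).

Definition residue (x : R) : R := x - a * (Num.floor (x / a))%:~R.

Lemma residue_itv x : 0 <= residue x < a.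
Proof.
have /andP[f1 f2] := floor_itv (x / a).
move: f1 f2; rewrite /residue ler_pdivlMr// ltr_pdivrMr// intrD => f1 f2.
by rewrite subr_ge0 ltrBlDr; apply/andP; split; lra.
Qed.

Lemma cosD2pi_int (x : R) (k : int) : cos (x + 2 * pi * k%:~R) = cos x.
Proof.
have E : forall (n : nat) (y : R), cos (y + 2 * pi * n%:R) = cos y.
  by move=> n y; rewrite mulr_natr mulr_natl; exact: (periodicn (@cosD2pi R)).
case: k => n; first exact: E.
by rewrite NegzE intrN mulrN -[LHS](E n.+1) subrK.
Qed.

Lemma sinD2pi_int (x : R) (k : int) : sin (x + 2 * pi * k%:~R) = sin x.
Proof. by rewrite -!cosBpihalf addrAC cosD2pi_int. Qed.

Lemma cos_residue (x b : R) : cos (w * x + b) = cos (w * residue x + b).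
Proof.
rewrite -(cosD2pi_int (w * residue x + b) (Num.floor (x / a))) -waE /residue.
by congr cos; ring.
Qed.

(** On [0, a[ the factor sin(w (a - y) / 2) is positive except at y = 0, where it
    is zero, and sin(w (y - c) / 2) has the sign of y - c. *)
Lemma arc_sin (c x : R) : 0 <= c < a ->
  (0 < sin (w * (residue x - c) / 2) * sin (w * (a - residue x) / 2)) =
  (c < residue x).
Proof.
move=> /andP[c0 ca]; have /andP[] := residue_itv x; move: (residue x) => y y0 ya.
have w0 : 0 < w by rewrite -(pmulr_lgt0 _ a_gt0) waE mulr_gt0// pi_gt0.
have waR := waE.
have wy : 0 < w * a - w * y by rewrite -mulrBr mulr_gt0 ?subr_gt0.
have wc := mulr_ge0 (ltW w0) c0.
rewrite !mulrBr; have [cy|yc] := ltP c y.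
  have wcy : 0 < w * y - w * c by rewrite -mulrBr mulr_gt0 ?subr_gt0.
  by apply/idP; apply: mulr_gt0; apply: sin_gt0_pi; apply/andP; split; lra.
have wcy : 0 <= w * c - w * y by rewrite -mulrBr mulr_ge0 ?subr_ge0// ltW.
have wac : 0 < w * a - w * c by rewrite -mulrBr mulr_gt0 ?subr_gt0.
have wy0 := mulr_ge0 (ltW w0) y0.
apply/negbTE; rewrite -leNgt.
have -> : (w * y - w * c) / 2 = - ((w * c - w * y) / 2) by lra.
rewrite sinN mulNr oppr_le0.
by apply: mulr_ge0; apply: sin_ge0_pi; apply/andP; split; lra.
Qed.

(** The product of sines in [arc_sin] is a trigonometric polynomial, so an arc is
    of the form v < 1/2 for a trigonometric polynomial v with values in [0, 1],
    to which [cvg_step] applies. *)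
Lemma arc_trig_limit (c : R) : 0 <= c < a -> trig_limit w [set x | c < residue x].
Proof.
move=> c0a.
(* the arc ]c, a[ has midpoint (c + a) / 2 and half-length (a - c) / 2 *)
pose v x := 1 / 2 - 1 / 4 * (cos (w * x - w * ((c + a) / 2)) - cos (w * ((a - c) / 2))).
have v01 x : 0 <= v x <= 1.
  rewrite /v; have := cos_max (w * x - w * ((c + a) / 2)).
  have := cos_max (w * ((a - c) / 2)).
  by rewrite !ler_norml => /andP[? ?] /andP[? ?]; apply/andP; split; lra.
have vE x : (v x < 1 / 2) = (c < residue x).
  rewrite -arc_sin// /v cos_residue; set y := residue x.
  have -> : cos (w * y - w * ((c + a) / 2)) - cos (w * ((a - c) / 2)) =
      2 * (sin (w * (y - c) / 2) * sin (w * (a - y) / 2)).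
    have -> : w * y - w * ((c + a) / 2) = w * (y - c) / 2 - w * (a - y) / 2 by lra.
    have -> : w * ((a - c) / 2) = w * (y - c) / 2 + w * (a - y) / 2 by lra.
    by rewrite cosB cosD; ring.
  by apply/idP/idP => h; lra.
have tv : trig_poly w v.
  have -> : v = (fun x => (1 / 2 + 1 / 4 * cos (w * ((a - c) / 2))) +
      - (1 / 4) * cos (1%:~R * w * x + - (w * ((c + a) / 2)))).
    by apply/funext => x; rewrite /v mulr1z [1 * w]mul1r; ring.
  by apply: trig_add; [exact: trig_cst|exact: trig_cos].
exists (fun n x => (1 - v x ^+ n) ^+ (n * 2 ^ n)); split=> [n|n x|x].
- by apply/trig_exp/trig_1B/trig_exp.
- have /andP[? ?] := v01 x.
  by rewrite exprn_ge0 ?exprn_ile1 ?subr_ge0 ?exprn_ile1 ?exprn_ge0 ?gerBl//= ?exprn_ge0.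
- suff -> : \1_[set x | c < residue x] x = (v x < 1 / 2)%R%:R :> R by exact: cvg_step.
  by rewrite indicE vE; congr (nat_of_bool _)%:R; apply/idP/idP;
    [move/set_mem|move=> ?; apply/mem_set].
Qed.

(** The arcs ]c, a[ pull back the rays that generate the Borel sets. *)
Lemma residue_trig_algebra (B : set R) : measurable B ->
  <<s trig_limit w >> (residue @^-1` B).
Proof.
move=> mB.
have mres : measurable_fun [set: g_sigma_algebraType (trig_limit w)] residue.
  apply: (measurability _ (RGenOInfty.measurableE R)) => _ [_ [c ->] <-].
  rewrite setTI.
  have [c0|c0] := ltP c 0.
    rewrite (_ : _ @^-1` _ = setT) ?preimage_setT//; apply/seteqP; split => // x _ /=.
    by rewrite in_itv/= andbT (lt_le_trans c0)//; have /andP[] := residue_itv x.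
  have [ac|ca] := leP a c.
    rewrite (_ : _ @^-1` _ = set0)//; apply/seteqP; split => // x /=.
    by rewrite in_itv/= andbT; have /andP[_ h] := residue_itv x; lra.
  apply: sub_sigma_algebra.
  rewrite (_ : _ @^-1` _ = [set x | c < residue x]); first exact/arc_trig_limit/andP.
  by apply/seteqP; split => x /=; rewrite in_itv/= andbT.
by have := mres measurableT _ mB; rewrite setTI.
Qed.

Lemma measurable_residue : measurable_fun [set: R] residue.
Proof.
move=> _ B mB; rewrite setTI; have := residue_trig_algebra mB; apply.
split; first exact: sigma_algebra_measurable.
exact: trig_limit_measurable.
Qed.

(** Uniqueness of Fourier coefficients for measures on the circle. *)
Lemma periodic_null (l : (R -> R) -> R) (B : set R) :
  sigma_continuous l -> trig_null w l -> measurable B -> l (\1_(residue @^-1` B)) = 0.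
Proof.
move=> fl l0 mB.
have l1 : l (fun=> 1) = 0 by exact: (trig_null_poly fl l0 (trig_cst _ _)).
suff H : <<s trig_limit w >> `<=` [set A | measurable A /\ l (\1_A) = 0].
  by have [] := H _ (residue_trig_algebra mB).
apply: lambda_system_subset => //; first exact: trig_limitI.
  exact: lambda_system_null.
move=> A lA; split; first exact: trig_limit_measurable lA.
exact: trig_null_limit lA.
Qed.

Lemma residue_id x : 0 <= x < a -> residue x = x.
Proof.
move=> /andP[x0 xa]; rewrite /residue (@floor_def _ _ 0) ?mulr0 ?subr0//.
by rewrite add0r divr_ge0 ?(ltW a_gt0)//= ltr_pdivrMr// mul1r.
Qed.

End periodic.

(** * The integral over one period *)

Section period_integral.
Context (R : realType) (a w : R).
Hypotheses (a_gt0 : 0 < a) (waE : w * a = 2 * pi).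
Local Notation lambda := (@lebesgue_measure R).

Definition period_integral (h : R -> R) : R :=
  \int[lambda]_x (h x * \1_(`[0, a[%classic : set R) x).

Lemma sigma_continuous_period_integral : sigma_continuous period_integral.
Proof.
apply: (@sigma_continuous_integral R _ _ lambda \1_(`[0, a[%classic : set R) id) => //.
exact: integrable_indic_itv.
Qed.

Lemma period_integralE (h : R -> R) : bounded_borel h ->
  period_integral h = \int[lambda]_(x in `[0, a]) h x.
Proof.
move=> bh; rewrite -Rintegral_itv_bndo_bndc; last first.
  have [mh [M hM]] := bh.
  apply: measurable_bounded_integrable => //=.
  - by rewrite lebesgue_measure_itv/= lte_fin a_gt0 -EFinD ltry.
  - exact: measurable_funS mh.
  - exists M; split; first by rewrite num_real.
    by move=> N MN x _ /=; rewrite (le_trans (hM x))// ltW.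
rewrite Rintegral_mkcond; apply: eq_Rintegral => x _.
by rewrite patchE indicE; case: ifPn; rewrite ?mulr1 ?mulr0.
Qed.

Lemma period_integral_cst r : period_integral (fun=> r) = r * a.
Proof.
rewrite period_integralE; last exact: bounded_borel_cst.
rewrite Rintegral_cst//= lebesgue_measure_itv/= lte_fin a_gt0.
by rewrite -EFinD/= subr0.
Qed.

Lemma period_integral_cos (k : int) b : k != 0 ->
  period_integral (fun x => cos (k%:~R * w * x + b)) = 0.
Proof.
move=> k0; rewrite period_integralE; last exact: bounded_borel_cos.
have w_neq0 : w != 0.
  by apply/eqP => w0; have := pi_gt0 R; have := waE; rewrite w0; lra.
set c := k%:~R * w; have c0 : c != 0 by rewrite mulf_neq0// intr_eq0.
pose F x : R := c^-1 * sin (c * x + b).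
have dF (x : R) : is_derive x 1 F (cos (c * x + b)).
  have dg : is_derive x 1 (fun y : R => c * y + b) c.
    by apply: is_derive_eq; rewrite addr0 /GRing.scale/= mulr1.
  have := is_deriveZ c^-1 (@is_derive1_comp R sin _ x _ _ (is_derive_sin (c * x + b)) dg).
  by rewrite /GRing.scale/= mulrCA mulVf// mulr1.
have cF : continuous F by move=> x; apply: differentiable_continuous; apply/derivable1_diffP.
rewrite /Rintegral (continuous_FTC2 (F := F))//.
- rewrite /F mulr0 add0r /c.
  have -> : k%:~R * w * a + b = b + 2 * pi * k%:~R by rewrite -waE; ring.
  by rewrite sinD2pi_int subee.
- by apply: continuous_subspaceT => x; exact: continuous_cos_affine.
- split.
  + by move=> x _; exact: ex_derive.
  + apply: cvg_at_right_filter; exact: cF.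
  + apply: cvg_at_left_filter; exact: cF.
- by move=> x _; rewrite derive1E derive_val.
Qed.

End period_integral.

(** * Functionals with band-limited transform *)

Section cosine_transform.
Context (R : realType) (N : (R -> R) -> R).
Hypothesis fN : sigma_continuous N.

(** The real part of e^(ib) N(e^(itx)). *)
Definition cos_transform (t b : R) : R := N (fun x => cos (t * x + b)).

(** The two phases 0 and pi / 2 carry the real and imaginary parts. *)
Lemma cos_transformE t b : cos_transform t b =
  cos b * cos_transform t 0 + sin b * cos_transform t (pi / 2).
Proof.
rewrite /cos_transform -(sigma_continuousZ _ fN (bounded_borel_cos _ _)).
rewrite -(sigma_continuousZ _ fN (bounded_borel_cos _ _)) -sigma_continuousD//.
- congr N; apply/funext => x.
  by rewrite addr0 cosDpihalf cosD; ring.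
- exact: bounded_borelZ (bounded_borel_cos _ _).
- exact: bounded_borelZ (bounded_borel_cos _ _).
Qed.

Lemma cos_transformN t b : cos_transform (- t) b = cos_transform t (- b).
Proof.
by congr N; apply/funext => x; rewrite -cosN; congr cos; ring.
Qed.

(** The real form of the fact that multiplying by a character shifts the transform. *)
Lemma cos_transformM r b t c :
  N (fun x => cos (r * x + b) * cos (t * x + c)) =
  (cos_transform (r + t) (b + c) + cos_transform (r - t) (b - c)) / 2.
Proof.
rewrite mulrC mulrDr /cos_transform -!(sigma_continuousZ _ fN (bounded_borel_cos _ _)).
rewrite -sigma_continuousD//; first last.
- exact: bounded_borelZ (bounded_borel_cos _ _).
- exact: bounded_borelZ (bounded_borel_cos _ _).
congr N; apply/funext => x; rewrite cosMcos -mulrDr mulrC.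
by congr (_ * (cos _ + cos _)); ring.
Qed.

End cosine_transform.

Section two_points.
Context (R : realType).
Local Notation lambda := (@lebesgue_measure R).

Lemma ae_witness (X : set R) (P : R -> Prop) :
  measurable X -> (0 < lambda X)%E -> {ae lambda, forall x, X x -> P x} ->
  exists2 x, X x & P x.
Proof.
move=> mX X_gt0 XP; apply: contrapT => nXP.
have : lambda X = 0%E.
  apply/negligibleP => //; apply: negligibleS XP => x Xx /= /(_ Xx) Px.
  by apply: nXP; exists x.
by move=> X0; move: X_gt0; rewrite X0 ltxx.
Qed.

Lemma ae_two_witnesses (X : set R) (P : R -> Prop) :
  measurable X -> (0 < lambda X)%E -> {ae lambda, forall x, X x -> P x} ->
  exists x y, [/\ X x, X y, x != y, P x & P y].
Proof.
move=> mX X_gt0 XP; have [x Xx Px] := ae_witness mX X_gt0 XP.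
have neqx : {ae lambda, forall y, y != x}.
  exists [set x]; split=> //; first exact: lebesgue_measure_set1.
  by move=> y /= /negP; rewrite negbK => /eqP.
have [|y Xy [Py yx]] := @ae_witness X (fun y => P y /\ y != x) mX X_gt0.
  move: XP neqx; apply: (@filterS2 _ _ (ae_filter_ringOfSetsType _)) => y XPy yx Xy.
  by split => //; exact: XPy.
by exists x, y; split; rewrite // eq_sym.
Qed.

End two_points.

Lemma cos_lt1 (R : realType) (u : R) : 0 < `|u| < 2 * pi -> cos u < 1.
Proof.
move=> /andP[u0 u1].
have -> : cos u = cos `|u| by case: ger0P => // _; rewrite cosN.
have -> : `|u| = `|u| / 2 + `|u| / 2 by lra.
have s0 : 0 < sin (`|u| / 2) by apply: sin_gt0_pi; apply/andP; split; lra.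
have := cos2Dsin2 (`|u| / 2); have := mulr_gt0 s0 s0.
by rewrite cosD !expr2; lra.
Qed.

Section periodic_uniqueness.
Context (R : realType) (a w : R).
Hypotheses (a_gt0 : 0 < a) (waE : w * a = 2 * pi).
Variable (N : (R -> R) -> R).
Hypothesis fN : sigma_continuous N.
Hypothesis N_band : forall t b, w <= `|t| -> cos_transform N t b = 0.
Local Notation C := (cos_transform N).

(** The real part of e^(ib) (c + d e^(iwx)), where c and d are the values of the
    transform at s and s - w. This is a times the density of the measure
    e^(isx) dN after folding modulo a, turned by e^(ib). *)
Definition period_density (s b x : R) : R :=
  C s b + C (s - w) (b + w * x).

Lemma period_densityE s b x : period_density s b x =
  C s b + (C (s - w) 0 * cos (w * x + b) + C (s - w) (pi / 2) * cos (w * x + (b - pi / 2))).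
Proof.
rewrite /period_density (cos_transformE fN (s - w)) [w * x + (b - _)]addrA cosBpihalf.
by rewrite [w * x + b]addrC mulrC [sin _ * _]mulrC.
Qed.

Lemma bounded_borel_period_density s b : bounded_borel (period_density s b).
Proof.
rewrite (funext (period_densityE s b)).
apply: bounded_borelD; first exact: bounded_borel_cst.
by apply: bounded_borelD; exact: bounded_borelZ (bounded_borel_cos _ _).
Qed.

Lemma frequency_gt0 : 0 < w.
Proof. by rewrite -(pmulr_lgt0 _ a_gt0) waE mulr_gt0// pi_gt0. Qed.

(** The coefficients of the folded measure are the values of the transform at
    s + kw. Those with k outside {0, -1} lie off the band, and the two others are
    the coefficients of the trigonometric polynomial that is subtracted. In real
    form the character k = 1 occurs too, through kw - s = - (s - w). *)
Lemma modulation_trig_null (s b : R) : 0 < s < w ->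
  trig_null w (fun h => N (fun x => h x * cos (s * x + b)) -
    period_integral a (fun x => h x * (a^-1 * period_density s b x))).
Proof.
move=> /andP[s0 sw] k c.
have fJ : sigma_continuous (period_integral a) := sigma_continuous_period_integral a.
have Jk (l : int) d : cos_transform (period_integral a) (l%:~R * w) d =
    (if l == 0 then a * cos d else 0).
  case: eqP => [->|/eqP l0]; last exact: period_integral_cos.
  rewrite /cos_transform; under eq_fun do rewrite !mul0r add0r.
  by rewrite period_integral_cst// mulrC.
have -> : (fun x => cos (k%:~R * w * x + c) * (a^-1 * period_density s b x)) =
  (fun x => a^-1 * C s b * cos (k%:~R * w * x + c) +
    (a^-1 * C (s - w) 0 * (cos (k%:~R * w * x + c) * cos (w * x + b)) +
     a^-1 * C (s - w) (pi / 2) * (cos (k%:~R * w * x + c) * cos (w * x + (b - pi / 2))))).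
  by apply/funext => x; rewrite period_densityE; ring.
have bc r d := bounded_borel_cos r d : bounded_borel (fun x : R => cos (r * x + d)).
have bcc r d r' d' := bounded_borelM (bc r d) (bc r' d').
rewrite sigma_continuousD//; last first.
- by apply: bounded_borelD; exact: bounded_borelZ (bcc _ _ _ _).
- exact: bounded_borelZ (bc _ _).
rewrite sigma_continuousD//; [|exact: bounded_borelZ (bcc _ _ _ _)..].
rewrite !sigma_continuousZ// !cos_transformM//.
rewrite -[period_integral a (fun x => cos _)]/
  (cos_transform (period_integral a) (k%:~R * w) c) Jk.
have kp : k%:~R * w + w = (k + 1)%:~R * w by rewrite intrD; ring.
have km : k%:~R * w - w = (k - 1)%:~R * w by rewrite intrB; ring.
rewrite kp km !Jk.
have a0 : a != 0 by rewrite gt_eqF.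
have sinE d : sin d = cos (d - pi / 2) by rewrite cosBpihalf.
have [k0|k0] := eqVneq k 0.
  rewrite k0 /= mulr0z mul0r sub0r add0r (cos_transformN N s) opprB.
  rewrite !(cos_transformE fN s (_ + _)) (cos_transformE fN s b).
  by rewrite (cosD c) (cosB b) (sinD c) (sinB b); field.
have w0 := frequency_gt0.
have [k1|k1] := eqVneq k 1.
  rewrite k1 /= mulr1z mul1r N_band; last by rewrite ger0_norm; lra.
  rewrite -(opprB s w) (cos_transformN N (s - w)) opprB (cos_transformE fN (s - w) (b - c)).
  have -> : cos (c - (b - pi / 2)) = sin (b - c).
    by rewrite sinE -cosN; congr cos; ring.
  have -> : cos (c - b) = cos (b - c) by rewrite -cosN opprB.
  by field.
have [kN1|kN1] := eqVneq k (-1).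
  rewrite kN1 /= mulrN1z mulN1r (@N_band (- w - s)); last first.
    by rewrite -opprD normrN ger0_norm; lra.
  have -> : - w + s = s - w by rewrite addrC.
  rewrite (cos_transformE fN (s - w) (c + b)).
  have -> : cos (c + (b - pi / 2)) = sin (c + b) by rewrite sinE addrA.
  by field.
(* now both kw + s and kw - s are at distance less than w from kw *)
have /orP kP : (1 < k) || (k < -1) by lia.
have kR : 2 * w <= `|k%:~R * w|.
  rewrite normrM [`|w|]gtr0_norm//; apply: ler_wpM2r; first exact: ltW.
  rewrite -intr_norm.
  suff : 2%:~R <= `|k|%:~R :> R by [].
  by rewrite ler_int; case: kP; lia.
have F1 : w <= `|k%:~R * w + s|.
  have := ler_normB (k%:~R * w + s) s; rewrite addrK [`|s|]gtr0_norm//; lra.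
have F2 : w <= `|k%:~R * w - s|.
  have := ler_normD (k%:~R * w - s) s; rewrite subrK [`|s|]gtr0_norm//; lra.
rewrite (N_band _ F1) (N_band _ F2).
have -> : (k + 1 == 0) = false by lia.
have -> : (k - 1 == 0) = false by lia.
by rewrite !(mulr0, mul0r, addr0, subr0).
Qed.

(** If c + d e^(iwx) = 0 at two points of a half-open period, then d = 0 by
    injectivity of x -> e^(iwx), hence c = 0. Below, p, q are the real coordinates
    of d, and |d|^2 |e^(iwx) - e^(iwy)|^2 = 0 is written out. *)
Lemma period_density_two_zeros (s x y : R) :
  0 <= x < a -> 0 <= y < a -> x != y ->
  period_density s 0 x = 0 /\ period_density s (pi / 2) x = 0 ->
  period_density s 0 y = 0 /\ period_density s (pi / 2) y = 0 ->
  forall b, C s b = 0.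
Proof.
move=> /andP[x0 xa] /andP[y0 ya] xy [Px0 Px1] [Py0 Py1] b.
have w0 := frequency_gt0.
have cxy : cos (w * x - w * y) < 1.
  apply: cos_lt1; rewrite -mulrBr normrM gtr0_norm// mulr_gt0 ?normr_gt0 ?subr_eq0//=.
  by rewrite -waE ltr_pM2l// ltr_norml; apply/andP; split; lra.
have E0 z : period_density s 0 z =
    C s 0 + (C (s - w) 0 * cos (w * z) + C (s - w) (pi / 2) * sin (w * z)).
  by rewrite period_densityE addr0 sub0r cosBpihalf.
have E1 z : period_density s (pi / 2) z =
    C s (pi / 2) + (C (s - w) 0 * - sin (w * z) + C (s - w) (pi / 2) * cos (w * z)).
  by rewrite period_densityE cosDpihalf subrr addr0.
move: Px0 Py0 Px1 Py1; rewrite !E0 !E1.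
rewrite (cos_transformE fN s b).
have := cos2Dsin2 (w * x); have := cos2Dsin2 (w * y); move: cxy; rewrite (cosB (w * x)).
move: (C s 0) (C s (pi / 2)) (C (s - w) 0) (C (s - w) (pi / 2)) (cos (w * x)) (sin (w * x))
  (cos (w * y)) (sin (w * y)) => A0 A1 p q cx sx cy sy cxy ny nx h1 h2 h3 h4.
have D : (p ^+ 2 + q ^+ 2) * ((cx - cy) ^+ 2 + (sx - sy) ^+ 2) = 0.
  have -> : (p ^+ 2 + q ^+ 2) * ((cx - cy) ^+ 2 + (sx - sy) ^+ 2) =
    (p * (cx - cy) + q * (sx - sy)) ^+ 2 + (q * (cx - cy) - p * (sx - sy)) ^+ 2 by ring.
  have -> : p * (cx - cy) + q * (sx - sy) = 0 by rewrite !mulrBr; lra.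
  have -> : q * (cx - cy) - p * (sx - sy) = 0 by rewrite !mulrBr; lra.
  by rewrite expr0n addr0.
have D0 : (cx - cy) ^+ 2 + (sx - sy) ^+ 2 != 0.
  rewrite gt_eqF//.
  have -> : (cx - cy) ^+ 2 + (sx - sy) ^+ 2 =
    (cx ^+ 2 + sx ^+ 2) + (cy ^+ 2 + sy ^+ 2) - 2 * (cx * cy + sx * sy) by ring.
  by rewrite nx ny; lra.
move/eqP: D; rewrite mulf_eq0 (negbTE D0) orbF paddr_eq0 ?sqr_ge0// !sqrf_eq0.
move=> /andP[/eqP p0 /eqP q0]; move: h1 h3; rewrite p0 q0 !mul0r !addr0 => -> ->.
by rewrite !mulr0 addr0.
Qed.

(** The measure e^(isx) dN, folded modulo a, has a constant multiple of
    [period_density] as its density and is zero on X. So the density vanishes at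
    almost every point of X, in particular at two of them. *)
Lemma band_limited_null (X : set R) (s : R) :
  measurable X -> X `<=` `[0, a[ -> (0 < @lebesgue_measure R X)%E ->
  (forall h, bounded_borel h -> (forall x, ~ X (residue a x) -> h x = 0) -> N h = 0) ->
  0 < s < w -> forall b, C s b = 0.
Proof.
move=> mX Xa X_gt0 N_X sw.
have iP b : (@lebesgue_measure R).-integrable X (EFin \o period_density s b).
  have [mP [M PM]] := bounded_borel_period_density s b.
  apply: measurable_bounded_integrable => //=.
  - rewrite (@le_lt_trans _ _ (@lebesgue_measure R `[0, a[%classic))//.
      by apply: le_measure => //; rewrite inE.
    by rewrite lebesgue_measure_itv/= lte_fin a_gt0 -EFinD ltry.
  - exact: measurable_funS mP.
  - exists M; split; first by rewrite num_real.
    by move=> K MK x _ /=; rewrite (le_trans (PM x))// ltW.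
have int0 b (B : set R) : measurable B -> B `<=` X ->
    (\int[@lebesgue_measure R]_(x in B) (period_density s b x)%:E = 0)%E.
  move=> mB BX.
  have mrB : measurable (residue a @^-1` B).
    by rewrite -[X in measurable X]setTI; exact: (measurable_residue a_gt0 waE).
  have fL : sigma_continuous (fun h => N (fun x => h x * cos (s * x + b)) -
    period_integral a (fun x => h x * (a^-1 * period_density s b x))).
    apply: sigma_continuousB; apply: sigma_continuousM.
    - exact: fN.
    - exact: bounded_borel_cos.
    - exact: sigma_continuous_period_integral.
    - exact: bounded_borelZ (bounded_borel_period_density s b).
  have := periodic_null a_gt0 waE fL (modulation_trig_null _ sw) mB.
  rewrite N_X; last 2 first.
  - exact: bounded_borelM (bounded_borel_indic mrB) (bounded_borel_cos _ _).
  - by move=> x nX; rewrite indicE memNset ?mul0r//= => /BX.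
  move=> /eqP; rewrite sub0r oppr_eq0 /period_integral.
  have -> : (fun x => \1_(residue a @^-1` B) x * (a^-1 * period_density s b x) * \1_`[0, a[ x) =
      (fun x => a^-1 * (period_density s b \_ B) x).
    apply/funext => x; rewrite patchE !indicE.
    have [xa|xa] := boolP (x \in `[0, a[%classic).
      have -> : (x \in residue a @^-1` B) = (x \in B).
        move: xa; rewrite inE /= in_itv/= => xa.
        by rewrite -[in RHS](residue_id a_gt0 xa); apply/idP/idP => /set_mem/mem_set.
      by case: ifPn => _; rewrite ?mul1r ?mul0r ?mulr1 ?mulr0.
    rewrite mulr0 ifF ?mulr0//; apply/negbTE; apply: contra xa => /set_mem Bx.
    exact/mem_set/Xa/BX.
  have iB : (@lebesgue_measure R).-integrable B (EFin \o period_density s b).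
    by apply: integrableS (iP b).
  rewrite RintegralZl//; last first.
    by rewrite -restrict_EFin; apply/integrable_restrict => //=; rewrite setTI.
  rewrite -Rintegral_mkcond mulf_eq0 invr_eq0 gt_eqF//= /Rintegral fine_eq0.
    by move/eqP.
  exact: integrable_fin_num.
have ae0 b : {ae @lebesgue_measure R, forall x, X x -> period_density s b x = 0}.
  have H : ae_eq (@lebesgue_measure R) X (EFin \o period_density s b) (fun=> 0%E).
    apply: integral_ae_eq => // B BX mB.
    by rewrite integral0; exact: int0.
  by move: H; apply: (@filterS _ _ (ae_filter_ringOfSetsType _)) => x /= + Xx => /(_ Xx) [].
have [|x [y [Xx Xy xy Px Py]]] := @ae_two_witnesses _ X
   (fun x => period_density s 0 x = 0 /\ period_density s (pi / 2) x = 0) mX X_gt0.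
  move: (ae0 0) (ae0 (pi / 2)); apply: (@filterS2 _ _ (ae_filter_ringOfSetsType _)) => x P0 P1 Xx.
  by split; [exact: P0|exact: P1].
have Xa' z : X z -> 0 <= z < a by move=> /Xa; rewrite /= in_itv.
exact: period_density_two_zeros (Xa' _ Xx) (Xa' _ Xy) xy Px Py.
Qed.

End periodic_uniqueness.

(** * Lebesgue measurable sets and the essential support *)

Local Open Scope complex_scope.

Section lebesgue_sigma_algebra.
Context (R : realType).

(** The value of the completed measure on an arbitrary set is an outer measure,
    so a null set is Caratheodory measurable without further hypothesis. *)
Lemma leb_null_negligible (A : set R) : leb R A = 0%E -> (leb R).-negligible A.
Proof.
move=> A0; apply/negligibleP => //; apply: le_caratheodory_measurable => X.
rewrite -[leRHS]add0e; apply: leeD; last by apply: le_outer_measure; exact: subIsetl.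
by rewrite -A0; apply: le_outer_measure; exact: subIsetr.
Qed.

Lemma borel_measurable_leb (A : set R) : measurable A ->
  (measurable : set (set (lebesgueTypeR R))) A.
Proof. exact: sub_caratheodory. Qed.

Lemma measurable_id_leb :
  measurable_fun [set: lebesgueTypeR R] (fun x : lebesgueTypeR R => x : R).
Proof. by move=> _ B mB; rewrite setTI; exact: borel_measurable_leb. Qed.

(** A probability is only given on Borel sets, so E has to be replaced by a Borel
    subset; a Lebesgue measurable set is the union of a Borel set and a null set. *)
Lemma leb_borel_core (E : set R) :
  (measurable : set (set (lebesgueTypeR R))) E -> (0 < leb R E)%E ->
  exists X : set R, [/\ measurable X, X `<=` E & (0 < @lebesgue_measure R X)%E].
Proof.
move=> mE E_gt0.
have : (completed_algebra_gen (@lebesgue_measure R)).-sigma.-measurable E.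
  by rewrite completed_caratheodory_measurable.
rewrite g_sigma_completed_algebra_genE => -[X mX [K [A [mA A0 KA]] XKE]].
exists X; split => //; first by rewrite -XKE; exact: subsetUl.
rewrite lt_neqAle measure_ge0 andbT eq_sym; apply/eqP => X0.
have XA0 : @lebesgue_measure R (X `|` A) = 0%E by rewrite null_set_setU.
move: E_gt0; apply/negP; rewrite -leNgt -XA0.
by apply: le_outer_measure; rewrite -XKE; exact: setUS.
Qed.

(** Each point off the support has a neighbourhood with rational endpoints where
    phi vanishes almost everywhere, and there are countably many of those. *)
Lemma ae_ess_support (phi : R -> R) : measurable_fun [set: lebesgueTypeR R] phi ->
  {ae leb R, forall x, ess_support phi x \/ phi x = 0}.
Proof.
move=> mphi.
pose Z := [set t : R | 0 < `|phi t|].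
pose I (q : rat * rat) := `](ratr q.1 : R), ratr q.2[%classic `&` Z.
pose F (n : nat) := if unpickle n is Some q then
  (if pselect ((leb R).-negligible (I q)) then I q else set0) else set0.
change ((leb R).-negligible (~` [set x | ess_support phi x \/ phi x = 0])).
apply: (@negligibleS _ _ _ (leb R) (\bigcup_n F n)); last first.
  apply: negligible_bigcup => n; rewrite /F; case: unpickle => [q|]; last exact: negligible_set0.
  by case: pselect => [//|h /=]; exact: negligible_set0.
move=> x /= /not_orP[nSx phix].
have [e [e0 eZ]] : exists e : R, 0 < e /\ leb R (`]x - e, x + e[ `&` Z) = 0%E.
  apply: contrapT => H; apply: nSx => e e0; rewrite lt_neqAle measure_ge0 andbT eq_sym.
  by apply/eqP => h; apply: H; exists e.
have /rat_in_itvoo[p] : x - e < x by lra.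
rewrite in_itv/= => /andP[p1 p2].
have /rat_in_itvoo[q] : x < x + e by lra.
rewrite in_itv/= => /andP[q1 q2].
have nIpq : (leb R).-negligible (I (p, q)).
  apply: negligibleS (leb_null_negligible eZ) => y [/=]; rewrite !in_itv/= => /andP[y1 y2] Zy.
  by split=> //=; rewrite ?in_itv/=; apply/andP; split; lra.
suff Fx : F (pickle (p, q)) x by exact: (ex_intro2 _ _ (pickle (p, q)) Logic.I Fx).
rewrite /F pickleK; case: pselect => //= _.
split; last by rewrite /Z /= normr_gt0; exact/eqP.
by rewrite /= in_itv/= p2 q1.
Qed.

End lebesgue_sigma_algebra.

Section difference_of_measures.
Context (R : realType) (mu : probability (measurableTypeR R) R) (phi : R -> R).
Hypothesis dphi : probability_density phi.

(** Integration against mu - phi dx; the factor 1 keeps both integrals in the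
    weighted form of [sigma_continuous_integral]. *)
Definition difference_functional (h : R -> R) : R :=
  \int[mu]_x (h x * 1) - \int[leb R]_x (h x * phi x).

Local Notation N := difference_functional.
Local Notation C := (cos_transform N).

Lemma sigma_continuous_difference : sigma_continuous N.
Proof.
have [iphi _ _] := dphi.
apply: sigma_continuousB.
  apply: (@sigma_continuous_integral R _ (measurableTypeR R) mu (cst 1) id) => //.
  exact: finite_measure_integrable_cst.
exact: (@sigma_continuous_integral R _ _ (leb R) phi id (@measurable_id_leb R) iphi).
Qed.

Lemma char_fun_difference t :
  char_fun mu t - density_char_fun phi t = C t 0 +i* C t (pi / 2).
Proof.
rewrite /char_fun /density_char_fun /cintegral /cos_transform /N.
have -> (a b c d : R) : (a +i* b) - (c +i* d) = (a - c) +i* (b - d) by [].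
congr ((_ - _) +i* (_ - _)); apply: eq_Rintegral => x _ /=.
- by rewrite mulr1 addr0 cosN.
- by rewrite mulr0 subr0 addr0 cosN.
- by rewrite mulr1 cosDpihalf sinN.
- by rewrite mulr0 add0r cosDpihalf sinN.
Qed.

Lemma char_fun_eqP t :
  density_char_fun phi t = char_fun mu t <-> forall b, C t b = 0.
Proof.
split=> [fg b|C0].
  have := char_fun_difference t; rewrite fg subrr => -[h0 h1].
  by rewrite (cos_transformE sigma_continuous_difference) -h0 -h1 !mulr0 addr0.
apply/esym/eqP; rewrite -subr_eq0 char_fun_difference !C0.
exact: eqxx.
Qed.

Lemma density_integral1 : \int[leb R]_x phi x = 1.
Proof.
have [iphi phi0] := dphi; rewrite Lnorm1 => h.
rewrite /Rintegral -[RHS]/(fine 1%E) -h; congr fine; apply: ae_eq_integral => //.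
- exact: measurable_int iphi.
- by apply: measurableT_comp => //; exact: measurable_int iphi.
- move: phi0; apply: (@filterS _ _ (ae_filter_ringOfSetsType _)) => x /= p0 _.
  by rewrite ger0_norm.
Qed.

Lemma difference_functional_cos0 b : C 0 b = 0.
Proof.
have fN := sigma_continuous_difference.
rewrite /cos_transform; under eq_fun do rewrite mul0r add0r -[cos b]mulr1.
rewrite sigma_continuousZ//; last exact: bounded_borel_cst.
rewrite /N; under eq_Rintegral do rewrite mulr1.
under [X in _ - X]eq_Rintegral do rewrite mul1r.
rewrite Rintegral_cst//= density_integral1 probability_setT mulr1.
by rewrite subrr mulr0.
Qed.

(** Continuity of the transform gives the endpoints |t| = sigma, which matter in
    the extreme case a = 2 pi / sigma. *)
Lemma cos_transform_band (sigma : R) : 0 < sigma ->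
  (forall t b, sigma < `|t| -> C t b = 0) ->
  forall t b, sigma <= `|t| -> C t b = 0.
Proof.
move=> s0 C0 t b st; have t0 : 0 < `|t| by lra.
have [_ NC] := sigma_continuous_difference.
pose t_ n := t * (1 + harmonic n).
have t_t : t_ @ \oo --> t.
  rewrite -[X in _ --> X]mulr1 -[X in _ * X]addr0.
  by apply: cvgM; [exact: cvg_cst|apply: cvgD; [exact: cvg_cst|exact: cvg_harmonic]].
have /cvg_lim : (fun n => C (t_ n) b) @ \oo --> C t b.
  apply: (NC _ _ 1) => [n|n x|x].
  - by case: (bounded_borel_cos (t_ n) b).
  - exact: cos_max.
  - apply: (@cvg_comp _ _ _ (fun n => t_ n * x + b) cos); last exact: continuous_cos.
    by apply: cvgD; [apply: cvgM; [exact: t_t|exact: cvg_cst]|exact: cvg_cst].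
move=> <- //; apply/cvg_lim => //; apply: cvg_near_cst; apply: nearW => n.
apply: C0; apply: le_lt_trans st _.
have h0 : 0 < (harmonic n : R) by rewrite /harmonic invr_gt0.
by rewrite /t_ normrM [`|1 + _|]gtr0_norm ?addr_gt0// ltr_pMr// ltrDl.
Qed.

End difference_of_measures.

(** * The difference of the two measures on periodic sets *)

Section null_periodic_set.
Context (R : realType) (a w : R) (mu : probability (measurableTypeR R) R) (phi : R -> R).
Hypotheses (a_gt0 : 0 < a) (waE : w * a = 2 * pi).
Hypothesis dphi : probability_density phi.
Local Notation N := (difference_functional mu phi).
Hypothesis N_band : forall t b, w <= `|t| -> cos_transform N t b = 0.

Lemma difference_trig_null : trig_null w N.
Proof.
move=> k b; rewrite -[LHS]/(cos_transform N (k%:~R * w) b).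
have [->|k0] := eqVneq k 0.
  by rewrite mul0r difference_functional_cos0.
apply: N_band; have w0 := frequency_gt0 a_gt0 waE.
rewrite normrM [`|w|]gtr0_norm// ler_peMl ?(ltW w0)// -intr_norm.
suff : 1%:~R <= `|k|%:~R :> R by [].
rewrite ler_int; lia.
Qed.

(** By [periodic_null] mu and phi dx give the same mass to X + aZ, and phi dx
    gives none. As mu is nonnegative, it has no mass on any subset either. *)
Lemma difference_functional_null (X : set R) : measurable X ->
  {ae leb R, forall x, X (residue a x) -> phi x = 0} ->
  forall h, bounded_borel h -> (forall x, ~ X (residue a x) -> h x = 0) -> N h = 0.
Proof.
move=> mX phiX.
have [iphi _ _] := dphi.
have phi_null h : bounded_borel h -> (forall x, ~ X (residue a x) -> h x = 0) ->
    \int[leb R]_x (h x * phi x) = 0.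
  move=> bh h0; rewrite /Rintegral (ae_eq_integral (fun=> 0%E))//.
  - by rewrite integral0.
  - exact: measurable_int (integrable_boundedM (@measurable_id_leb R) iphi bh).
  - move: phiX; apply: (@filterS _ _ (ae_filter_ringOfSetsType _)) => x /= pX _.
    have [/pX ->|/h0 ->] := pselect (X (residue a x)); first by rewrite mulr0.
    by rewrite mul0r.
have mY : measurable (residue a @^-1` X).
  by rewrite -[X in measurable X]setTI; exact: (measurable_residue a_gt0 waE).
have muY : mu (residue a @^-1` X) = 0%E.
  have := periodic_null a_gt0 waE (sigma_continuous_difference mu dphi)
    difference_trig_null mX.
  rewrite /difference_functional phi_null; last 2 first.
  - exact: bounded_borel_indic.
  - by move=> x nX; rewrite indicE memNset.
  under eq_Rintegral do rewrite mulr1.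
  rewrite subr0 /Rintegral integral_indic// setIT => /eqP.
  by rewrite fine_eq0 ?fin_num_measure// => /eqP.
move=> h bh h0; rewrite /difference_functional phi_null// subr0 /Rintegral.
rewrite (ae_eq_integral (fun=> 0%E))//; first by rewrite integral0.
  by under eq_fun do rewrite mulr1; apply/measurable_EFinP; case: bh.
exists (residue a @^-1` X); split => // x /= /not_implyP[_ hx].
by apply: contrapT => /h0 hx0; apply: hx; rewrite hx0 mul0r.
Qed.

End null_periodic_set.

Theorem theorem1p3 (R : realType) (sigma : R) (sigma_gt0 : 0 < sigma)
    (phi : R -> R) (phi_density : probability_density phi)
    (f : R -> R[i]) (fE : f = density_char_fun phi)
    (a : R) (a_gt0 : 0 < a)
    (E : set R)
    (mE : (measurable : set (set (lebesgueTypeR R))) E)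
    (E_sub : E `<=` `[0, a[)
    (E_gt0 : (0 < leb R E)%E)
    (E_null : leb R (periodization E a `&` ess_support phi) = 0%E)
    (g : R -> R[i]) (g_char : is_char_fun g)
    (fg : forall t, t \in U sigma -> f t = g t)
    (a_le : a <= 2 * pi / sigma) :
  forall t : R, f t = g t.
Proof.
have [mu gE] := g_char.
pose w := 2 * pi / a.
have waE : w * a = 2 * pi by rewrite /w divfK// gt_eqF.
have sw : sigma <= w by move: a_le; rewrite /w !ler_pdivlMr// mulrC.
pose N := difference_functional mu phi.
have N_band t b : w <= `|t| -> cos_transform N t b = 0.
  move=> wt; apply: (cos_transform_band phi_density sigma_gt0) (le_trans sw wt) => {wt}t {}b st.
  by move: b; apply/(char_fun_eqP mu phi_density); rewrite -fE -gE; apply/fg/mem_set.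
have [X [mX XE X_gt0]] := leb_borel_core mE E_gt0.
have phiX : {ae leb R, forall x, X (residue a x) -> phi x = 0}.
  have [iphi _ _] := phi_density.
  have mphi : measurable_fun [set: lebesgueTypeR R] phi.
    by apply/measurable_EFinP; exact: measurable_int iphi.
  have E0 : {ae leb R, forall x, ~ (periodization E a `&` ess_support phi) x}.
    by apply: negligibleS (leb_null_negligible E_null) => x /= /contrapT.
  move: (ae_ess_support mphi) E0; apply: (@filterS2 _ _ (ae_filter_ringOfSetsType _)).
  move=> x /= [Sx|//] ESx Xx; exfalso; apply: ESx; split=> //.
  exists (residue a x); first exact: XE.
  by exists (Num.floor (x / a)) => //; rewrite /residue subrK.
have N_X := difference_functional_null a_gt0 waE phi_density N_band mX phiX.
have Xa : X `<=` `[0, a[ by apply: subset_trans E_sub.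
have N0 t b : 0 < t < w -> cos_transform N t b = 0.
  move=> tw; exact: (band_limited_null a_gt0 waE (sigma_continuous_difference mu phi_density)
    N_band mX Xa X_gt0 N_X tw).
move=> t; rewrite fE gE; apply/(char_fun_eqP mu phi_density) => b.
have [wt|tw] := leP w `|t|; first exact: N_band.
have [t0|t0|->] := ltgtP t 0.
- rewrite -(opprK t) cos_transformN; apply: N0.
  by move: tw; rewrite ltr0_norm// oppr_gt0 t0.
- by apply: N0; rewrite t0/=; move: tw; rewrite gtr0_norm.
- exact: difference_functional_cos0.
Qed.
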